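(* Let $\mathcal{H}$ be a hypergraph with at least one hyperedge. For any fixed hyperedge $e\in E(\mathcal{H})$ and every $p\in\mathbb{N}$, adjoining $p$ new degree-one vertices to $e$ (that is, adding $p$ new vertices to the vertex set and replacing $e$ by its union with the set of these $p$ vertices) leaves $\mathcal{L}(\mathcal{H})$ unchanged. Consequently, every hypergraph with at least one hyperedge shares its line multigraph with infinitely many other hypergraphs.
   Context: A hypergraph $\mathcal{H}=(V,E)$ consists of a finite set $V$ of vertices and a set $E$ of non-empty subsets of $V$, called hyperedges. All hypergraphs are assumed simple (no hyperedge has cardinality one and no hyperedge is contained in another) and connected (any two vertices are joined by a path, i.e. an alternating sequence of distinct vertices and hyperedges in which each hyperedge contains the vertices immediately before and after it). The degree of a vertex is the number of hyperedges containing it. The line multigraph $\mathcal{L}(\mathcal{H})$ is the multigraph with vertex set $E$ in which two distinct vertices $e,f\in E$ are joined by exactly $|e\cap f|$ edges (no loops). Equality of line multigraphs of two hypergraphs is understood up to identification of vertices: there is a bijection between the hyperedge sets preserving $|e\cap f|$ for all pairs of distinct hyperedges (here the bijection sends the modified hyperedge to the original one and fixes all others). *)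

(* Defs.v *)
From HB Require Import structures.
From mathcomp Require Import all_boot.

Set Implicit Arguments.
Unset Strict Implicit.
Unset Printing Implicit Defensive.

Record hypergraph := Hypergraph {
  vertex : finType;
  edges : {set {set vertex}};
  edges_nonempty : set0 \notin edges
}.

Definition degree (H : hypergraph) (v : vertex H) : nat :=
  #|[set e in edges H | v \in e]|.

Definition simple (H : hypergraph) : Prop :=
  (forall e, e \in edges H -> #|e| != 1) /\
  (forall e f, e \in edges H -> f \in edges H -> e \subset f -> e = f).

(* The alternating sequence x, e_1, v_1, ..., e_k, v_k is encoded as the      *)
(* starting vertex x together with s = [:: (e_1, v_1); ...; (e_k, v_k)].      *)
Fixpoint walk (H : hypergraph) (x : vertex H)
    (s : seq ({set vertex H} * vertex H)) : bool :=
  if s is (e, y) :: s' then [&& e \in edges H, x \in e, y \in e & walk y s']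
  else true.

Definition hyperpath (H : hypergraph) (x y : vertex H)
    (s : seq ({set vertex H} * vertex H)) : bool :=
  [&& walk x s, last x (unzip2 s) == y, uniq (x :: unzip2 s) & uniq (unzip1 s)].

Definition connected (H : hypergraph) : Prop :=
  forall x y : vertex H, exists s, hyperpath x y s.

Definition hypergraph_iso (H K : hypergraph) : Prop :=
  exists2 f : vertex H -> vertex K,
    bijective f & edges K = [set f @: (e : {set vertex H}) | e in edges H].

(* mult x y is the number of edges joining x and y. *)
Record multigraph := Multigraph {
  node : finType;
  mult : node -> node -> nat;
  mult_sym : forall x y, mult x y = mult y x
}.

Definition is_multigraph_iso (G K : multigraph) (phi : node G -> node K) : Prop :=
  bijective phi /\ forall x y, mult (phi x) (phi y) = mult x y.

Definition multigraph_iso (G K : multigraph) : Prop :=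
  exists phi : node G -> node K, is_multigraph_iso phi.

Definition hyperedge (H : hypergraph) : finType :=
  {e : {set vertex H} | e \in edges H}.

Definition vertices_of (H : hypergraph) (e : hyperedge H) : {set vertex H} :=
  val e.

Definition line_mult (H : hypergraph) (e f : hyperedge H) : nat :=
  if e == f then 0 else #|vertices_of e :&: vertices_of f|.

Fact line_mult_sym (H : hypergraph) (e f : hyperedge H) :
  line_mult e f = line_mult f e.
Proof. by rewrite /line_mult eq_sym setIC. Qed.

Definition line_multigraph (H : hypergraph) : multigraph :=
  @Multigraph (hyperedge H) (@line_mult H) (@line_mult_sym H).

(* The p new vertices are the elements inr i of the disjoint sum V + 'I_p;    *)
(* old vertices and hyperedges are identified with their images under inl.    *)
Definition old_edge (V : finType) (p : nat) (f : {set V}) : {set V + 'I_p} :=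
  [set inl v | v in f].

Definition adjoined_edge (V : finType) (p : nat) (e : {set V}) :
    {set V + 'I_p} :=
  old_edge p e :|: [set inr i | i : 'I_p].

Definition adjoin_edges (H : hypergraph) (e : {set vertex H}) (p : nat) :
    {set {set vertex H + 'I_p}} :=
  adjoined_edge p e |: [set old_edge p f | f in edges H :\ e].

Fact adjoin_edges_nonempty (H : hypergraph) (e : hyperedge H) (p : nat) :
  set0 \notin adjoin_edges (vertices_of e) p.
Proof.
have old0 (f : {set vertex H}) : f \in edges H -> old_edge p f != set0.
  move=> fE; rewrite imset_eq0; apply: contraNneq (edges_nonempty H) => <-.
  exact: fE.
rewrite !inE negb_or eq_sym setU_eq0 negb_and old0 ?(valP e) //=.
apply/imsetP => -[f]; rewrite inE => /andP[_ /old0].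
by rewrite eq_sym => /eqP.
Qed.

Definition adjoin (H : hypergraph) (e : hyperedge H) (p : nat) : hypergraph :=
  @Hypergraph (vertex H + 'I_p)%type (adjoin_edges (vertices_of e) p)
    (adjoin_edges_nonempty e p).

(* Main.v *)
Require Import Defs.
From HB Require Import structures.
From mathcomp Require Import all_boot.

(* The new vertices lie only in the extended copy of e, so they never enter   *)
(* an intersection of two distinct hyperedges: restricting hyperedges to the  *)
(* old vertices is an isomorphism of line multigraphs. The hypergraphs        *)
(* obtained for different p are told apart by their numbers of vertices.      *)

(** The map [extended_edge] from old to new hyperedges is inverted by taking traces on the old
    vertices ([extended_edgeK]), and it preserves the sizes of intersections of distinct hyperedges
    ([extended_edgeI]), which gives [restrict_edge_iso]. It remains to see that [adjoin e p] is
    again simple and connected. Connectedness is the delicate point, since paths may repeat neither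
    vertices nor hyperedges; [hyperpath_step] settles this by prepending a hyperedge to a path and
    cutting out any repetition. *)

Lemma hyperpath_last_visit {H : hypergraph} (e : {set vertex H}) z y s :
    hyperpath z y s -> has (fun v => v \in e) (z :: unzip2 s) ->
  exists w t, [/\ hyperpath w y t, w \in e & {in unzip2 t, forall v, v \notin e}].
Proof.
elim: s z => [|[f v] s IHs] z hp.
  by rewrite /= orbF => ze; exists z, [::].
(* If the tail still meets [e], the last visit lies in the tail; otherwise it is [z] itself. *)
case hs: (has (fun v => v \in e) (v :: unzip2 s)).
  move=> _; apply: IHs hs; move: hp; rewrite /hyperpath /=.
  by case/and4P=> /and4P[_ _ _ ->] -> /andP[_ ->] /andP[_ ->].
rewrite [has _ _]/= -[_ || has _ _]/(has _ (v :: unzip2 s)) hs orbF => ze.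
by exists z, ((f, v) :: s); split=> // u us; apply: (hasPn (negbT hs)).
Qed.

(* Leaving e for good at the last vertex of the path that lies in e keeps all *)
(* vertices and hyperedges distinct.                                          *)
Lemma hyperpath_step {H : hypergraph} {e : {set vertex H}} {x z y s} :
    e \in edges H -> x \in e -> z \in e -> hyperpath z y s ->
  exists t, hyperpath x y t.
Proof.
move=> eE xe ze hp.
have [|w [t [hpt we te]]] := hyperpath_last_visit e z y s hp; first by rewrite /= ze.
have [<-|neq_wx] := eqVneq w x; first by exists t.
exists ((e, w) :: t); move: (hpt); rewrite /hyperpath /= eE xe we /=.
case/and4P=> wt -> /andP[-> ->] ->; rewrite wt inE eq_sym negb_or neq_wx !andbT /=.
rewrite (contraL (te x)) ?xe //=.
(* It remains to show that [e] does not occur among the hyperedges of [t]: each of these contains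
   the vertex that follows it, and that vertex lies outside [e]. *)
have {hpt neq_wx we} : walk w t by [].
elim: t w te {wt} => //= -[f u] t IHt w te /and4P[_ _ uf wt].
rewrite inE negb_or; apply/andP; split.
  by apply: contraTneq uf => /= <-; apply: te; rewrite /= mem_head.
by apply: (IHt u) => // v vt; apply: te; rewrite /= inE vt orbT.
Qed.

Lemma card_hypergraph_iso {H K : hypergraph} :
  hypergraph_iso H K -> #|vertex H| = #|vertex K|.
Proof. by case=> f /bij_eq_card. Qed.

Section Adjoin.

Variables (H : hypergraph) (e : hyperedge H) (p : nat).

(** Treats the modified hyperedge and the others uniformly, so that the new hyperedge set is the
    image of the old one under a single map. *)
Definition extended_edge (f : {set vertex H}) : {set vertex H + 'I_p} :=
  if f == vertices_of e then adjoined_edge p f else old_edge p f.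

Lemma edges_adjoin : edges (adjoin e p) = [set extended_edge f | f in edges H].
Proof.
rewrite /= /adjoin_edges -[in RHS](setD1K (valP e)) imsetU1 /extended_edge eqxx.
congr (_ |: _); apply: eq_in_imset => f.
by rewrite !inE => /andP[/negPf ->].
Qed.

Lemma mem_extended_edge f : f \in edges H -> extended_edge f \in edges (adjoin e p).
Proof. by move=> fE; rewrite edges_adjoin imset_f. Qed.

Lemma inl_old_edge (f : {set vertex H}) v : (inl v \in old_edge p f) = (v \in f).
Proof. by apply: mem_imset => a b []. Qed.

Lemma inr_old_edge (f : {set vertex H}) i : (inr i \in old_edge p f) = false.
Proof. by apply/imsetP => -[]. Qed.

Lemma inl_extended_edge f v : (inl v \in extended_edge f) = (v \in f).
Proof.
rewrite /extended_edge; case: ifP => _; rewrite ?inE inl_old_edge //.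
by rewrite orb_idr // => /imsetP[].
Qed.

Lemma inr_extended_edge f i : (inr i \in extended_edge f) = (f == vertices_of e).
Proof.
rewrite /extended_edge; case: ifP => _; rewrite ?inE inr_old_edge //=.
exact: imset_f.
Qed.

Lemma extended_edgeK : cancel extended_edge (fun x => inl @^-1: x).
Proof. by move=> f; apply/setP=> v; rewrite inE inl_extended_edge. Qed.

Lemma card_old_edge (f : {set vertex H}) : #|old_edge p f| = #|f|.
Proof. by apply: card_imset => a b []. Qed.

(** A new vertex common to both sides would force [f] and [g] both to be [e]. *)
Lemma extended_edgeI f g : f != g ->
  extended_edge f :&: extended_edge g = old_edge p (f :&: g).
Proof.
move=> neq_fg; apply/setP=> -[v|i]; rewrite inE.
  by rewrite !inl_extended_edge inl_old_edge inE.
rewrite !inr_extended_edge inr_old_edge; apply: contraNF neq_fg.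
by case/andP=> /eqP-> /eqP->.
Qed.

(** Extending a nonempty hyperedge cannot lower its size to one, and an inclusion between extended
    hyperedges restricts to their traces. *)
Lemma simple_adjoin : simple H -> simple (adjoin e p).
Proof.
case=> card_neq1 incl; split=> [x|x y]; rewrite edges_adjoin.
  case/imsetP=> f fE ->; apply: contraNneq (card_neq1 f fE) => card1.
  have f_gt0 : 0 < #|f|.
    by rewrite card_gt0; apply: contraNneq (edges_nonempty H) => <-.
  rewrite eqn_leq f_gt0 -card1 -(card_old_edge f) subset_leq_card //.
  by apply/subsetP=> _ /imsetP[v vf ->]; rewrite inl_extended_edge.
case/imsetP=> f fE -> /imsetP[g gE ->] /(preimsetS inl).
by rewrite !extended_edgeK => /(incl f g fE gE)->.
Qed.

(** Working back from the end of the walk, [hyperpath_step] prepends each extended hyperedge in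
    turn. *)
Lemma walk_adjoin x s (y : vertex (adjoin e p)) : walk x s ->
    (exists t, hyperpath (inl (last x (unzip2 s)) : vertex (adjoin e p)) y t) ->
  exists t, hyperpath (inl x : vertex (adjoin e p)) y t.
Proof.
elim: s x => [|[f v] s IHs] x //= /and4P[fE xf vf ws] hp.
have [t hpt] := IHs v ws hp.
by apply: (hyperpath_step (mem_extended_edge f fE) _ _ hpt);
  rewrite inl_extended_edge.
Qed.

Lemma connected_adjoin : connected H -> connected (adjoin e p).
Proof.
move=> Hconn.
have eE : vertices_of e \in edges H := valP e.
have [u ue] : exists u, u \in vertices_of e.
  by apply/set0Pn; apply: contraNneq (edges_nonempty H) => <-.
have e'E := mem_extended_edge _ eE.
have refl (z : vertex (adjoin e p)) : hyperpath z z [::].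
  by rewrite /hyperpath /= eqxx.
have from_old v (y : vertex (adjoin e p)) :
    exists t, hyperpath (inl v : vertex (adjoin e p)) y t.
  case: y => [w|i].
    have [s /and4P[ws /eqP lst _ _]] := Hconn v w.
    by apply: (walk_adjoin _ _ _ ws); rewrite lst; exists [::].
  (* A new vertex is reached through [u], an old vertex of [e], and then the extended copy of
     [e]. *)
  have [s /and4P[ws /eqP lst _ _]] := Hconn v u.
  apply: (walk_adjoin _ _ _ ws); rewrite lst.
  by apply: (hyperpath_step e'E _ _ (refl (inr i)));
    rewrite ?inl_extended_edge ?inr_extended_edge.
case=> [v|i] y; first exact: from_old.
have [t hpt] := from_old u y.
by apply: (hyperpath_step e'E _ _ hpt);
  rewrite ?inl_extended_edge ?inr_extended_edge.
Qed.

Lemma degree_adjoin_inr i : degree (inr i : vertex (adjoin e p)) = 1.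
Proof.
rewrite /degree -[RHS](cards1 (extended_edge (vertices_of e))).
congr #|pred_of_set _|; apply/setP=> x; rewrite in_set in_set1.
apply/andP/eqP=> [[] | ->]; last first.
  by rewrite mem_extended_edge ?(valP e) // inr_extended_edge.
by rewrite edges_adjoin => /imsetP[f _ ->]; rewrite inr_extended_edge => /eqP->.
Qed.

Lemma vertices_of_adjoin (x : hyperedge (adjoin e p)) :
  exists2 f, f \in edges H & vertices_of x = extended_edge f.
Proof.
have : vertices_of x \in edges (adjoin e p) := valP x.
by rewrite edges_adjoin => /imsetP.
Qed.

Fact restrict_edge_subproof (x : hyperedge (adjoin e p)) :
  inl @^-1: vertices_of x \in edges H.
Proof. by have [f fE ->] := vertices_of_adjoin x; rewrite extended_edgeK. Qed.

Definition restrict_edge (x : hyperedge (adjoin e p)) : hyperedge H :=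
  exist (fun f => f \in edges H) _ (restrict_edge_subproof x).

Definition extend_hyperedge (f : hyperedge H) : hyperedge (adjoin e p) :=
  exist (fun x => x \in edges (adjoin e p)) _ (mem_extended_edge _ (valP f)).

Lemma extend_hyperedgeK : cancel extend_hyperedge restrict_edge.
Proof. by move=> f; apply: val_inj; rewrite /= /vertices_of /= extended_edgeK. Qed.

Lemma restrict_edgeK : cancel restrict_edge extend_hyperedge.
Proof.
move=> x; apply: val_inj; have [f _ eq_x] := vertices_of_adjoin x.
change (extended_edge (inl @^-1: vertices_of x) = vertices_of x).
by rewrite eq_x extended_edgeK.
Qed.

Lemma restrict_edge_iso :
  @is_multigraph_iso (line_multigraph (adjoin e p)) (line_multigraph H)
    restrict_edge.
Proof.
split; first exact: Bijective restrict_edgeK extend_hyperedgeK.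
move=> x y; rewrite -[x]restrict_edgeK -[y]restrict_edgeK.
move: (restrict_edge x) (restrict_edge y) => f g.
rewrite !extend_hyperedgeK /= /line_mult (can_eq extend_hyperedgeK).
have [//|neq_fg] := eqVneq f g.
by rewrite extended_edgeI ?card_old_edge // (inj_eq val_inj).
Qed.

Lemma restrict_edge_eq (x : hyperedge (adjoin e p)) (f : hyperedge H) :
  vertices_of x = extended_edge (vertices_of f) -> restrict_edge x = f.
Proof. by move=> eq_x; apply: val_inj; rewrite /= eq_x extended_edgeK. Qed.

End Adjoin.

Theorem mainTheorem13 (H : hypergraph) (Hsimple : simple H)
    (Hconn : connected H) (Hne : edges H != set0) :
  (forall (e : hyperedge H) (p : nat),
     [/\ simple (adjoin e p),
         connected (adjoin e p),
         (forall i : 'I_p, degree (inr i : vertex (adjoin e p)) = 1) &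
         exists phi : hyperedge (adjoin e p) -> hyperedge H,
           [/\ @is_multigraph_iso (line_multigraph (adjoin e p))
                 (line_multigraph H) phi,
               (forall x : hyperedge (adjoin e p),
                  vertices_of x = adjoined_edge p (vertices_of e) ->
                  phi x = e) &
               (forall (x : hyperedge (adjoin e p)) (f : hyperedge H),
                  f != e -> vertices_of x = old_edge p (vertices_of f) ->
                  phi x = f)]])
  /\
  (exists F : nat -> hypergraph,
     [/\ (forall n, simple (F n) /\ connected (F n)),
         (forall n, ~ hypergraph_iso (F n) H),
         (forall m n, m <> n -> ~ hypergraph_iso (F m) (F n)) &
         (forall n, multigraph_iso (line_multigraph (F n)) (line_multigraph H))]).
Proof.
split=> [e p|].
  split; [exact: simple_adjoin | exact: connected_adjoin
         | exact: degree_adjoin_inr |].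
  exists (restrict_edge H e p); split; first exact: restrict_edge_iso.
    by move=> x eq_x; apply: restrict_edge_eq; rewrite /extended_edge eqxx.
  move=> x f neq_fe eq_x; apply: restrict_edge_eq.
  by rewrite /extended_edge (inj_eq val_inj) (negPf neq_fe).
have [e0 e0E] := set0Pn _ Hne.
pose e : hyperedge H := exist (fun f => f \in edges H) e0 e0E.
have cardF n : #|vertex (adjoin e n)| = #|vertex H| + n.
  by rewrite card_sum card_ord.
(* The successor ensures that at least one vertex is added, so every member also differs from
   [H]. *)
exists (fun n => adjoin e n.+1); split=> [n|n|m n neq_mn|n].
- by split; [apply: simple_adjoin | apply: connected_adjoin].
- move/card_hypergraph_iso/eqP.
  by rewrite cardF -[X in _ == X]addn0 eqn_add2l.
- by move/card_hypergraph_iso/eqP; rewrite !cardF eqn_add2l eqSS => /eqP.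
- by exists (restrict_edge H e n.+1); apply: restrict_edge_iso.
Qed.
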